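(* For every integer $k \geq 3$ there exist affinely inequivalent finite sets of integers $A$ and $B$ such that $|A| = |B| = k$ and $|hA| = |hB|$ for all integers $h \geq 2$.
   Context: For a nonempty finite set $A$ of integers and a positive integer $h$, the $h$-fold sumset $hA$ is the set of all sums of $h$ not necessarily distinct elements of $A$, and $|hA|$ denotes its cardinality. Two sets of integers $A$ and $B$ are affinely equivalent if there exist rational numbers $\lambda$ and $\mu$ with $\lambda \neq 0$ such that $B = \{\lambda x + \mu : x \in A\}$; otherwise they are affinely inequivalent. *)

(* Defs.v *)
From mathcomp Require Import all_boot all_order all_algebra.
From mathcomp Require Import finmap.

Set Implicit Arguments.
Unset Strict Implicit.
Unset Printing Implicit Defensive.

Import Order.TTheory GRing.Theory Num.Theory.

Local Open Scope fset_scope.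
Local Open Scope ring_scope.

Definition sumset (h : nat) (A : {fset int}) : {fset int} :=
  [fset \sum_(i < h) val (f i) | f : {ffun 'I_h -> A} in predT].

Definition affinely_equivalent (A B : {fset int}) : Prop :=
  exists lambda mu : rat,
    lambda != 0 /\
    [fset y%:~R | y in B] = [fset lambda * x%:~R + mu | x in A] :> {fset rat}.

(* Main.v *)
(** If gcd(g, m) = 1 and m is a sum of g elements of A, then in a sum of
    elements of gA together with m the summand m is needed fewer than g times,
    and its multiplicity is then determined by the residue modulo g. Hence the
    h-fold sumset of the glued set has size sum_{j < min(g, h+1)} |(h-j)A|,
    whatever m is. Gluing first with g = 5 to {0, 1}, with m = 1 or m = 2, and
    then repeatedly with g = 2, with m = 1 or m = 5 respectively, gives two
    sets of any size k >= 3 with equal sumset sizes. After n gluings with g = 2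
    both sets have extremes 0 and M = 5 * 2^n, so an affine equivalence would
    be x |-> x or x |-> M - x; but 1 is in the first set, while the elements
    of the second are multiples of 5 or equal to 2^(n+1), which excludes 1 and
    M - 1. *)

Require Import Defs.
From mathcomp Require Import all_boot all_order all_algebra.
From mathcomp Require Import finmap.
From mathcomp Require Import zify ring.

Set Implicit Arguments.
Unset Strict Implicit.
Unset Printing Implicit Defensive.

Import Order.TTheory GRing.Theory Num.Theory.

Local Open Scope fset_scope.
Local Open Scope ring_scope.

(** * Sumsets through sequences of summands *)

Lemma sumsetP (h : nat) (A : {fset int}) (z : int) :
  reflect (exists s : seq int,
             [/\ size s = h, {subset s <= A} & z = \sum_(x <- s) x])
          (z \in sumset h A).
Proof.
apply: (iffP (imfsetP _ _ _ _)) => [[f _ ->]|[s [sz_s sA ->]]].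
  exists [seq val (f i) | i <- enum 'I_h]; split.
  - by rewrite size_map size_enum_ord.
  - by move=> x /mapP[i _ ->]; apply: valP.
  - by rewrite big_map big_enum.
have sAi (i : 'I_h) : s`_i \in A by rewrite sA // mem_nth // sz_s.
exists [ffun i => FSetSub (sAi i)] => //.
rewrite (big_nth 0) sz_s big_mkord.
by apply: eq_bigr => i _; rewrite ffunE.
Qed.

Lemma sumset0 (A : {fset int}) : sumset 0 A = [fset 0].
Proof.
apply/fsetP => z; rewrite inE; apply/sumsetP/eqP => [[s [/size0nil-> _ ->]]|->].
  by rewrite big_nil.
by exists [::]; rewrite big_nil.
Qed.

Lemma mem_sumset1 (A : {fset int}) (x : int) : x \in A -> x \in sumset 1 A.
Proof.
move=> xA; apply/sumsetP; exists [:: x].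
by rewrite big_seq1; split=> // y; rewrite inE => /eqP->.
Qed.

Lemma mem_sumsetD (h i : nat) (A : {fset int}) (x y : int) :
  x \in sumset h A -> y \in sumset i A -> x + y \in sumset (h + i) A.
Proof.
move=> /sumsetP[s [<- sA ->]] /sumsetP[t [<- tA ->]].
apply/sumsetP; exists (s ++ t); rewrite size_cat big_cat; split=> //.
by move=> z; rewrite mem_cat => /orP[/sA|/tA].
Qed.

Lemma mem_sumsetS (h : nat) (A : {fset int}) (z : int) :
  z \in sumset h.+1 A ->
  exists x y, [/\ x \in A, y \in sumset h A & z = x + y].
Proof.
move=> /sumsetP[[|x s] [//= [sz_s] sA ->]]; exists x, (\sum_(y <- s) y).
split; last by rewrite big_cons.
  by rewrite sA ?mem_head.
by apply/sumsetP; exists s; split=> // y ys; rewrite sA // inE ys orbT.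
Qed.

(** * Gluing one element to a dilate *)

Definition glue (g : nat) (m : int) (A : {fset int}) : {fset int} :=
  m |` [fset g%:Z * x | x in A].

Lemma glueP (g : nat) (m : int) (A : {fset int}) (z : int) :
  reflect (z = m \/ exists2 x, x \in A & z = g%:Z * x) (z \in glue g m A).
Proof.
rewrite !inE; apply: (iffP orP) => -[].
- by move/eqP; left.
- by move/imfsetP=> [x xA ->]; right; exists x.
- by move->; left.
- by case=> x xA ->; right; apply/imfsetP; exists x.
Qed.

Lemma mem_glue_gen (g : nat) (m : int) (A : {fset int}) : m \in glue g m A.
Proof. by apply/glueP; left. Qed.

Lemma mem_glue_scale (g : nat) (m : int) (A : {fset int}) (x : int) :
  x \in A -> g%:Z * x \in glue g m A.
Proof. by move=> xA; apply/glueP; right; exists x. Qed.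

(** Here [j] counts the copies of [m]. The bound [minn g h.+1] says both [j < g] and [j <= h], so
    [h - j] is never truncated. *)
Lemma sumset_glueP (g : nat) (m : int) (A : {fset int}) (h : nat) (z : int) :
  (0 < g)%N -> m \in sumset g A ->
  reflect (exists j y, [/\ (j < minn g h.+1)%N, y \in sumset (h - j) A
                         & z = g%:Z * y + j%:Z * m])
          (z \in sumset h (glue g m A)).
Proof.
move=> g0 mgA; apply: (iffP idP).
  elim: h z => [|h IHh] z.
    rewrite sumset0 inE => /eqP->; exists 0%N, 0.
    by rewrite sumset0 inE; split=> //; lia.
  case/mem_sumsetS=> x [_ [/glueP xG /IHh[j [y [jlt yA ->]]] ->]].
  case: xG => [->|[a aA ->]]; last first.
    exists j, (a + y); split; [lia | | ring].
    have -> : (h.+1 - j = 1 + (h - j))%N by lia.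
    exact: mem_sumsetD (mem_sumset1 aA) yA.
  have [jg|jg] := ltnP j.+1 g.
    by exists j.+1, y; split; [lia | rewrite subSS | rewrite intS; ring].
  (* [g] copies of [m] are traded for [g] elements of the dilate of [A] with the same sum *)
  exists 0%N, (y + m); split; [lia | | ].
    have -> : (h.+1 - 0 = (h - j) + g)%N by lia.
    exact: mem_sumsetD yA mgA.
  have -> : g = j.+1 by lia.
  by rewrite intS; ring.
case=> j [y [jlt yA ->]].
have -> : h = ((h - j) + j)%N by lia.
apply: mem_sumsetD.
  elim: (h - j)%N y yA => [|i IHi] y.
    by rewrite !sumset0 !inE => /eqP->; rewrite mulr0.
  case/mem_sumsetS=> a [y' [aA /IHi y'G ->]].
  by rewrite mulrDr; apply: (mem_sumsetD (mem_sumset1 _) y'G);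
    apply: mem_glue_scale.
elim: j {jlt yA} => [|j IHj]; first by rewrite sumset0 inE mul0r.
have -> : j.+1%:Z * m = m + j%:Z * m by rewrite intS; ring.
by apply: (mem_sumsetD (mem_sumset1 _) IHj); apply: mem_glue_gen.
Qed.

Lemma card_scale (g : nat) (c : int) (A : {fset int}) :
  (0 < g)%N -> #|` [fset g%:Z * x + c | x in A]| = #|` A|.
Proof. by move=> g0; rewrite card_imfset // => x y /= ?; nia. Qed.

(** Modulo [g] the equation reads [(i - j) * m = 0]; coprimality gives [g %| i - j], while
    [|i - j| < g]. *)
Lemma mul_coprime_inj (g : nat) (m : int) (i j : nat) (x y : int) :
  coprimez g m -> (i < g)%N -> (j < g)%N ->
  g%:Z * x + i%:Z * m = g%:Z * y + j%:Z * m -> i = j.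
Proof.
move=> cgm ilt jlt E.
have : (g %| (i%:Z - j%:Z))%Z.
  by rewrite -(Gauss_dvdzl _ cgm); apply/dvdzP; exists (y - x); lia.
case/dvdzP=> q; have [->|[]] : q = 0 \/ 1 <= q \/ q <= -1 by lia.
- by lia.
- by nia.
- by nia.
Qed.

(** The sums with exactly [j] copies of [m] form an affine image of [sumset (h - j) A], and
    different [j] give different residues modulo [g]. The resulting count is free of [m]. *)
Lemma card_sumset_glue (g : nat) (m : int) (A : {fset int}) (h : nat) :
  (0 < g)%N -> coprimez g m -> m \in sumset g A ->
  #|` sumset h (glue g m A)| =
    (\sum_(0 <= j < minn g h.+1) #|` sumset (h - j) A|)%N.
Proof.
move=> g0 cgm mgA; set n := minn g h.+1.
pose F j := [fset g%:Z * y + j%:Z * m | y in sumset (h - j) A].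
have -> : sumset h (glue g m A) = \bigcup_(j <- [fset j in index_iota 0 n]) F j.
  apply/fsetP => z; apply/(sumset_glueP _ _ g0 mgA)/bigfcupP.
    case=> j [y [jlt yA ->]]; exists j; first by rewrite !inE mem_index_iota jlt.
    by apply/imfsetP; exists y.
  case=> j; rewrite !inE mem_index_iota andbT /= => jlt.
  by case/imfsetP=> y /= yA ->; exists j, y.
rewrite card_fset_sum1 partition_disjoint_bigfcup => [|i j].
  rewrite (perm_big (index_iota 0 n)) /=; last first.
    apply: uniq_perm; rewrite ?fset_uniq ?iota_uniq // => j.
    by rewrite !inE.
  by apply: eq_bigr => j _; rewrite -card_fset_sum1 card_scale.
rewrite !inE !mem_index_iota /= => ilt jlt; apply: contra_neqT.
case/fset0Pn=> z; rewrite inE => /andP[/imfsetP[x _ ->] /imfsetP[y _ /= E]].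
by apply: (mul_coprime_inj cgm _ _ E);
  [move: ilt | move: jlt]; rewrite leq_min => /andP[].
Qed.

Lemma card_glue (g : nat) (m : int) (A : {fset int}) :
  (1 < g)%N -> coprimez g m -> #|` glue g m A| = #|` A|.+1.
Proof.
move=> g1 cgm; rewrite cardfsU1.
have -> : [fset g%:Z * x | x in A] = [fset g%:Z * x + 0 | x in A].
  by apply: eq_imfset => // x /=; rewrite addr0.
(* If [m] were a multiple of [g], then [g > 1] would divide the gcd, which is 1. *)
rewrite card_scale 1?ltnW //; case: imfsetP => // -[x _ E].
move: cgm; rewrite E addr0 /coprimez => /eqP cgm.
have : (g %| gcdz g (g%:Z * x))%Z by rewrite dvdz_gcd dvdzz dvdz_mulr.
by rewrite cgm dvdzE /= dvdn1; lia.
Qed.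

(** * Iterated gluing *)

Definition tower (a m : int) (n : nat) : {fset int} :=
  iter n (glue 2 m) (glue 5 a [fset 0; 1]).

Lemma sumset_nat_01 (g a : nat) : (a <= g)%N -> a%:Z \in sumset g [fset 0; 1].
Proof.
move=> ag; apply/sumsetP; exists (nseq a 1 ++ nseq (g - a) 0).
rewrite size_cat !size_nseq big_cat /= !big_nseq; split; first lia.
  by move=> x; rewrite mem_cat !mem_nseq !inE => /orP[] /andP[_ ->]; rewrite ?orbT.
by rewrite !iter_addr_0 mul0rn addr0 natz.
Qed.

Lemma mem_tower0 (a m : int) (n : nat) : 0 \in tower a m n.
Proof.
elim: n => [|n IHn] /=; apply/glueP; right; exists 0 => //.
by rewrite !inE eqxx.
Qed.

Lemma mem_tower_max (a m : int) (n : nat) : 5 * 2 ^+ n \in tower a m n.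
Proof.
elim: n => [|n IHn] /=; apply/glueP; right.
  by exists 1; rewrite // !inE eqxx orbT.
by exists (5 * 2 ^+ n) => //; rewrite exprS; ring.
Qed.

Lemma mem_tower_gen (a m : int) (n : nat) :
  m \in tower a m 0 -> m \in tower a m n.
Proof. by case: n => // n _; apply: mem_glue_gen. Qed.

Lemma sumset2_tower_gen (a m : int) (n : nat) :
  m \in tower a m 0 -> m \in sumset 2 (tower a m n).
Proof.
move=> m0; have := mem_sumsetD (mem_sumset1 (mem_tower_gen n m0))
  (mem_sumset1 (mem_tower0 a m n)).
by rewrite addr0.
Qed.

(** The bound 10 on [m] is the maximum [5 * 2] after the first gluing with 2; later maxima are
    larger. *)
Lemma tower_bounds (a m : int) (n : nat) (x : int) :
  0 <= a <= 5 -> 0 <= m <= 10 -> x \in tower a m n -> 0 <= x <= 5 * 2 ^+ n.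
Proof.
move=> ha hm; elim: n x => [|n IHn] x /= /glueP[->|[y yA ->]].
- by rewrite expr0; lia.
- by move: yA; rewrite !inE expr0 => /orP[] /eqP->.
- by have : 1 <= 2 ^+ n :> int by [rewrite exprn_ege1]; rewrite exprS; lia.
- by move/IHn: yA; rewrite exprS; lia.
Qed.

Lemma card_tower (a m : int) (n : nat) :
  coprimez 5 a -> coprimez 2 m -> #|` tower a m n| = n.+3.
Proof.
move=> ca cm; elim: n => [|n IHn] /=; rewrite card_glue ?IHn //.
by rewrite cardfs2.
Qed.

(** The base count depends only on 5 and [{0, 1}]. Each further gluing sums over several [h - j], so
    the induction keeps [h] general. *)
Lemma card_sumset_tower (a b : nat) (m p : int) (n h : nat) :
  (a <= 5)%N -> (b <= 5)%N -> coprimez 5 a -> coprimez 5 b ->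
  coprimez 2 m -> coprimez 2 p -> m \in tower a m 0 -> p \in tower b p 0 ->
  #|` sumset h (tower a m n)| = #|` sumset h (tower b p n)|.
Proof.
move=> ha hb ca cb cm cp ma pb; elim: n h => [|n IHn] h /=.
  by rewrite !card_sumset_glue // sumset_nat_01.
rewrite !card_sumset_glue // ?sumset2_tower_gen //.
by apply: eq_bigr => j _; apply: IHn.
Qed.

(** * Affine inequivalence *)

(** Only the initial generator 2 is not a multiple of 5, and every gluing doubles it. *)
Lemma tower_25_shape (n : nat) (x : int) :
  x \in tower 2 5 n -> (5 %| x)%Z \/ x = 2 ^+ n.+1.
Proof.
elim: n x => [|n IHn] x /= /glueP[->|[y yA ->]].
- by right.
- by left; rewrite dvdz_mulr.
- by left.
- case/IHn: yA => [d|->]; [left | right].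
    by rewrite dvdz_mull.
  by rewrite -exprS.
Qed.

Lemma affinely_equivalent_interval (M : int) (A B : {fset int}) :
  0 < M ->
  {in A, forall x, 0 <= x <= M} -> {in B, forall x, 0 <= x <= M} ->
  0 \in A -> M \in A -> 0 \in B -> M \in B ->
  affinely_equivalent A B ->
  {subset A <= B} \/ {in A, forall x, M - x \in B}.
Proof.
move=> M0 AM BM A0 AMx B0 BMx [l [mu [_ E]]].
have toB x : x \in A -> exists2 y, y \in B & y%:~R = l * x%:~R + mu :> rat.
  move=> xA; have : l * x%:~R + mu \in [fset (y%:~R : rat) | y in B].
    by rewrite E; apply/imfsetP; exists x.
  by case/imfsetP=> y yB ->; exists y.
have toA y : y \in B -> exists2 x, x \in A & y%:~R = l * x%:~R + mu :> rat.
  move=> yB; have : y%:~R \in [fset l * x%:~R + mu | x in A].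
    by rewrite -E; apply/imfsetP; exists y.
  by case/imfsetP=> x xA ->; exists x.
have [u uB Eu] := toB _ A0; have [v vB Ev] := toB _ AMx.
(* The map sends 0 to [u] and [M] to [v]; eliminating [l] and [mu] leaves an identity over the
   integers. *)
have slope z w : w%:~R = l * z%:~R + mu -> (w - u) * M = z * (v - u).
  move=> Ew; apply: (@intr_inj rat).
  by rewrite !rmorphM !rmorphB /= Ew Ev Eu; ring.
have [x xA /slope Ex] := toA _ B0; have [y yA /slope Ey] := toA _ BMx.
(* Subtract the slope identities for the preimages [x] of 0 and [y] of [M]. Both factors are at most
   [M] in absolute value, so [v - u] is [M] or [- M]. *)
have D : (v - u) * (y - x) = M * M by lia.
have := (AM _ xA, AM _ yA, BM _ uB, BM _ vB) => -[[[bx bY] bu] bv].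
have [Dv|Dv] : v - u = M \/ v - u = - M by nia.
- left=> z zA; have [w wB /slope Ew] := toB _ zA.
  by have -> : z = w by rewrite Dv in Ew; nia.
- right=> z zA; have [w wB /slope Ew] := toB _ zA.
  by have -> : M - z = w by rewrite Dv in Ew; nia.
Qed.

Theorem theorem4 (k : nat) (hk : (3 <= k)%N) :
  exists A B : {fset int},
    [/\ ~ affinely_equivalent A B,
        #|` A| = k,
        #|` B| = k &
        forall h : nat, (2 <= h)%N -> #|` sumset h A| = #|` sumset h B|].
Proof.
have [n ->] : exists n, k = n.+3 by exists (k - 3)%N; lia.
have one1 : 1 \in tower 1 1 0 by apply: mem_glue_gen.
exists (tower 1 1 n), (tower 2 5 n); split.
- have p1 : 1 <= 2 ^+ n :> int by rewrite exprn_ege1.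
  have bA x : x \in tower 1 1 n -> 0 <= x <= 5 * 2 ^+ n by exact: tower_bounds.
  have bB x : x \in tower 2 5 n -> 0 <= x <= 5 * 2 ^+ n by exact: tower_bounds.
  case/(affinely_equivalent_interval _ bA bB) => [||||| /(_ 1) | /(_ 1)];
    rewrite ?mem_tower0 ?mem_tower_max //; first lia.
    by move/(_ (mem_tower_gen n one1)) => /tower_25_shape[//|]; rewrite exprS; lia.
  (* With [M = 5 * 2 ^+ n], [M - 1 = 2 ^+ n.+1] would give [3 * 2 ^+ n = 1], and [M - 1] is -1
     modulo 5. *)
  move/(_ (mem_tower_gen n one1)) => /tower_25_shape[|]; last by rewrite exprS; lia.
  by case/dvdzP=> q; lia.
- exact: card_tower.
- exact: card_tower.
- move=> h _; apply: card_sumset_tower => //.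
  (* The remaining condition is that 5 lies in the base set, where it is the maximum
     [5 * 2 ^+ 0]. *)
  exact: (mem_tower_max 2 5 0).
Qed.
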